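(* Let $\ell\ge 7$ be odd and let $v\equiv \ell\pmod{2\ell}$ be a positive integer. Then there is an equitably $2$-colourable $\ell$-cycle decomposition of $K_v$.
   Context: An $\ell$-cycle decomposition of $K_v$ is a set of $\ell$-cycles whose edge sets partition $E(K_v)$. It is equitably $2$-colourable if there is a colouring of the vertices with two colours such that every cycle contains $\lfloor \ell/2\rfloor$ or $\lceil \ell/2\rceil$ vertices of each colour. *)

(* Defs.v *)
From mathcomp Require Import all_boot.

Set Implicit Arguments.
Unset Strict Implicit.
Unset Printing Implicit Defensive.

(* Graphs on the finite vertex type V are given by their edge sets, an edge
   being a two-element set of vertices. A cycle is the subgraph itself, not a
   rooted and oriented traversal of it, so it too is represented by its edge
   set E; as it has no isolated vertices, its vertex set is [cover E]. *)

Definition complete_edges (V : finType) : {set {set V}} :=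
  [set e : {set V} | #|e| == 2].

Definition cycle_edges (V : finType) (c : seq V) : {set {set V}} :=
  [set [set x; next c x] | x in c].

(* Without [2 < l], a closed walk of length 1 or 2 would count as a cycle. *)
Definition is_cycle (V : finType) (l : nat) (E : {set {set V}}) : bool :=
  (2 < l) && [exists c : l.-tuple V, uniq c && (E == cycle_edges c)].

Definition cycle_decomposition (V : finType) (l : nat)
    (D : {set {set {set V}}}) : Prop :=
  {in D, forall E, is_cycle l E} /\ partition D (complete_edges V).

Definition equitable_colouring (V : finType) (l : nat)
    (D : {set {set {set V}}}) (col : V -> bool) : Prop :=
  forall E, E \in D -> forall a : bool,
    let k := #|[set x in cover E | col x == a]| in
    (k == l./2) || (k == uphalf l).

Definition equitably_2_colourable (V : finType) (l : nat)
    (D : {set {set {set V}}}) : Prop :=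
  exists col : V -> bool, equitable_colouring l D col.

(* Main.v *)
Require Import Defs.
From mathcomp Require Import all_boot all_algebra zify.
Import GRing.Theory.

(* Write l = 2n+1, v = l(2k+1), and take Z_(2k+1) x X as vertex set, where
   X = Z_2n + {oo}, coloured by the X-coordinate. Edges of Z-difference 0 form
   copies of K_l, and are decomposed into Walecki's Hamiltonian cycles. For the
   nonzero differences, short-cut the vertex a in the a-th Walecki cycle, for
   all a in Z_2n: the short-cuts free the cycle (0, 1, ..., 2n-1), which misses
   oo, and these 2n+1 cycles C_a on X \ {a} traverse every ordered pair (x, y)
   with x != y exactly once. Insert into C_a a loop at p a, where p is a
   colour-preserving derangement of X; the closed walk of length l so obtained
   has the same colour count as X. Give the pairs symmetric weights +1 or -1
   such that the weight of each C_a is 2 or 4, and the loop of C_a the opposite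
   of the weight of C_a. All weights are units modulo 2k+1, so the lifts of the
   walks with voltages d * weight, for d = 1, ..., k, are cycles that cover each
   edge of nonzero difference exactly once. *)

(** * Cycle decompositions from closed sequences *)

Lemma next_mkseq (V : eqType) (f : nat -> V) l t :
  {in gtn l &, injective f} -> f l = f 0 -> t < l ->
  next (mkseq f l) (f t) = f t.+1.
Proof.
move=> f_inj fl tl; have us : uniq (mkseq f l) by apply/mkseq_uniqP.
have ft : f t \in mkseq f l by apply: map_f; rewrite mem_iota.
rewrite next_nth ft -{2}(nth_mkseq (f 0) f tl) index_uniq ?size_mkseq //.
case: l {us ft} f_inj fl tl => // l _ fl tl.
rewrite /mkseq /=; have [tl'|lt'] := ltnP t l.
  by rewrite (nth_map 0) ?size_iota // nth_iota.
(* At the last position [nth] runs off the tail and returns its default, the head [f 0], which is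
   [f l]. *)
by rewrite nth_default ?size_map ?size_iota // -fl; congr f; lia.
Qed.

Lemma cover_cycle_edges (V : finType) (c : seq V) :
  cover (cycle_edges c) = [set x in c].
Proof.
apply/setP=> x; rewrite inE; apply/bigcupP/idP => [[_ /imsetP[y yc ->]]|xc].
  by rewrite !inE => /orP[]/eqP-> //; rewrite mem_next.
by exists [set x; next c x]; [apply: imset_f | rewrite !inE eqxx].
Qed.

(* Pairwise disjointness of the edge sets comes for free from the count
   [#|A| * l = 'C(#|V|, 2)] once every edge is covered. *)
Lemma decomposition_of_cover (V A : finType) (l : nat) (f : A -> nat -> V)
    (col : V -> bool) :
  2 < l -> (forall a, {in gtn l &, injective (f a)}) ->
  (forall a, f a l = f a 0) ->
  (forall x y, x != y -> exists a t,
     t < l /\ [set x; y] = [set f a t; f a t.+1]) ->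
  #|A| * l = 'C(#|V|, 2) ->
  (forall a b, let q := count (fun x => col x == b) (mkseq (f a) l) in
     (q == l./2) || (q == uphalf l)) ->
  exists D, cycle_decomposition (V:=V) l D /\ equitably_2_colourable l D.
Proof.
move=> l2 f_inj fl f_cov cardA f_col.
have us a : uniq (mkseq (f a) l) by apply/mkseq_uniqP; apply: f_inj.
pose E a := cycle_edges (mkseq (f a) l).
have Esize a : #|E a| <= l.
  by rewrite (leq_trans (leq_imset_card _ _)) // (card_uniqP (us a)) size_mkseq.
have Edge a t : t < l -> [set f a t; f a t.+1] \in E a.
  move=> tl; rewrite -(next_mkseq _ _ _ _ (f_inj a) (fl a) tl).
  by apply: imset_f; apply: map_f; rewrite mem_iota.
have E2 a e : e \in E a -> #|e| == 2.
  case/imsetP=> x /mapP[t]; rewrite mem_iota /= add0n => tl -> ->.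
  rewrite cards2 next_mkseq //; move: tl; rewrite leq_eqVlt => /orP[/eqP tl|tl].
    rewrite [in f a t.+1]tl fl; rewrite eqSS eqb1; apply/eqP => e0.
    by have : t = 0 by [apply: (f_inj a _ _ _ _ e0); rewrite inE; lia]; lia.
  rewrite eqSS eqb1; apply/eqP => e0.
  by have : t = t.+1 by [apply: (f_inj a _ _ _ _ e0); rewrite inE; lia]; lia.
pose D := [set E a | a in A].
have covD : cover D = complete_edges V.
  apply/setP=> e; rewrite inE; apply/bigcupP/idP => [[_ /imsetP[a _ ->]]|].
    exact: E2.
  case/cards2P=> x [y [xy ->]]; have [a [t [tl ->]]] := f_cov _ _ xy.
  by exists (E a); [apply: imset_f | apply: Edge].
exists D; split; last first.
  exists col => _ /imsetP[a _ ->] b.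
  rewrite /E cover_cycle_edges; set q := #|_|.
  suff -> : q = count (fun x => col x == b) (mkseq (f a) l) by apply: f_col.
  rewrite /q -size_filter -(card_uniqP _) ?filter_uniq //.
  by apply: eq_card => x; rewrite inE inE mem_filter andbC.
split=> [_ /imsetP[a _ ->]|].
  rewrite /is_cycle l2; apply/existsP.
  exists (Tuple (introT eqP (size_mkseq (f a) l))).
  by rewrite /= us eqxx.
have tD : trivIset D.
  rewrite -(leq_card_cover D).2 eqn_leq (leq_card_cover D).1 /=.
  rewrite covD (_ : #|complete_edges V| = 'C(#|V|, 2)); last first.
    by rewrite -card_draws; apply: eq_card => e; rewrite !inE.
  rewrite -cardA (@leq_trans (\sum_(B in D) l)) //.
    by apply: leq_sum => _ /imsetP[a _ ->].
  by rewrite sum_nat_const leq_mul // leq_imset_card.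
rewrite /partition covD eqxx tD /=; apply/imsetP=> [[a _ E0]].
by have := Edge a 0 (ltnW (ltnW l2)); rewrite -E0 inE.
Qed.

(** * Units modulo 2k+1 *)

(* The units modulo every odd number that serve as voltages. *)
Definition signed_pow2 (z : int) : Prop := exists e, `|z|%N = 2 ^ e.

Lemma signed_pow2_inj k (w : int) : signed_pow2 w ->
  injective (fun z : 'I_k.*2.+1 => (z *~ w)%R).
Proof.
case=> e we x y /eqP; rewrite -subr_eq0 -mulrzBl => /eqP xy0.
apply/eqP; rewrite -subr_eq0; move: (x - y)%R xy0 => z zw.
have {zw} : (z *+ 2 ^ e = 0)%R.
  rewrite -we; case: w zw {we} => q //=.
  by rewrite NegzE mulrNz => /eqP; rewrite oppr_eq0 => /eqP.
rewrite Zp_mulrn => /(congr1 val) /= /eqP; rewrite -/(dvdn _ _).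
rewrite Gauss_dvdl ?coprimeXr ?coprimen2 /= ?odd_double //.
by case: (posnP z) => [z0 _|z0]; [apply/eqP/val_inj | rewrite gtnNdvd].
Qed.

(** Multiplication by [w] permutes the residues, and up to sign the nonzero ones are 1, ..., k. The
    index [d] counts from 0, hence [d.+1]. *)
Lemma half_system k (w : int) (z : 'I_k.*2.+1) : signed_pow2 w -> z != 0%R ->
  exists d : 'I_k, z = (inord d.+1 *~ w)%R \/ (- z)%R = (inord d.+1 *~ w)%R.
Proof.
move=> w2 z0; have [g _ gK] := injF_bij (signed_pow2_inj k w w2).
have y0 : g z != 0%R by apply: contra_neq z0 => y0; rewrite -(gK z) y0 mul0rz.
have y1 : 0 < g z by rewrite lt0n; apply: contra_neq y0 => y0; apply: val_inj.
have yk := ltn_ord (g z).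
have [le|gt] := leqP (g z) k.
  have dk : (g z).-1 < k by lia.
  exists (Ordinal dk); left; rewrite -{1}(gK z); congr (_ *~ _)%R.
  by apply: val_inj; rewrite /= inordK; lia.
have dk : k.*2 - g z < k by lia.
exists (Ordinal dk); right; rewrite -{1}(gK z) -mulNrz; congr (_ *~ _)%R.
by apply: val_inj; rewrite /= inordK ?modn_small; lia.
Qed.

(** * Lifts of closed walks with one loop *)

Definition walk_weight (X : Type) (w : X -> X -> int) (c : nat -> X) (u : nat) :=
  (\sum_(0 <= s < u) w (c s) (c s.+1))%R.

(* The loop at [c r] is inserted just after time [r], with the voltage that
   closes the lift. *)
Definition lift_with_loop k (X : finType) (w : X -> X -> int) (c : nat -> X)
    (N r : nat) (i d : 'I_k.*2.+1) (t : nat) : 'I_k.*2.+1 * X :=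
  let S := walk_weight X w c in
  if t <= r then (i + d *~ S t, c t)%R
  else (i + d *~ (S t.-1 - S N), c t.-1)%R.

Lemma lift_with_loop_closed k (X : finType) w (c : nat -> X) N r
    (i d : 'I_k.*2.+1) :
  r < N -> c N = c 0 ->
  lift_with_loop k X w c N r i d N.+1 = lift_with_loop k X w c N r i d 0.
Proof.
move=> rN cN; rewrite /lift_with_loop leqNgt ltnW //= cN subrr.
by rewrite /walk_weight big_geq.
Qed.

(** A vertex of X repeats only at the two ends of the loop, and there the Z-coordinates differ by
    [d] times the total weight. *)
Lemma lift_with_loop_inj k (X : finType) w (c : nat -> X) N r
    (i d : 'I_k.*2.+1) :
  {in gtn N &, injective c} -> (d *~ walk_weight X w c N != 0)%R -> r < N ->
  {in gtn N.+1 &, injective (lift_with_loop k X w c N r i d)}.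
Proof.
move=> c_inj S0 rN.
have clash s t : s <= r -> r < t -> t < N.+1 ->
    lift_with_loop k X w c N r i d s <> lift_with_loop k X w c N r i d t.
  move=> sr rt tN; rewrite /lift_with_loop sr leqNgt rt /=.
  move=> e; have /c_inj := congr1 snd e; rewrite !inE /= => st.
  have {}st : s = t.-1 by apply: st; lia.
  have := congr1 fst e; rewrite /= -st => /eqP.
  rewrite (inj_eq (addrI i)).
  by rewrite mulrzBr eq_sym -subr_eq0 addrAC subrr sub0r oppr_eq0 (negPf S0).
move=> s t; rewrite !inE => sN tN.
have [sr|rs] := leqP s r; have [tr|rt] := leqP t r.
- rewrite /lift_with_loop sr tr => -[_ /c_inj]; rewrite !inE => -> //; lia.
- by move/clash => /(_ sr rt tN).
- by move/esym/clash => /(_ tr rs sN).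
rewrite /lift_with_loop (leqNgt s) (leqNgt t) rs rt /= => e.
have /c_inj := congr1 snd e; rewrite !inE /=; lia.
Qed.

(** The start [i] is solved for from [j]; steps beyond the loop occur one time unit later, hence the
    two cases. *)
Lemma lift_with_loop_step k (X : finType) w (c : nat -> X) N r
    (d j : 'I_k.*2.+1) t :
  t < N -> exists i s, [/\ s < N.+1,
    lift_with_loop k X w c N r i d s = (j, c t) &
    lift_with_loop k X w c N r i d s.+1 = (j + d *~ w (c t) (c t.+1), c t.+1)%R].
Proof.
move=> tN; rewrite /lift_with_loop.
have St : walk_weight X w c t.+1 = (walk_weight X w c t + w (c t) (c t.+1))%R.
  by rewrite /walk_weight big_nat_recr.
have [tr|rt] := ltnP t r.
  exists (j - d *~ walk_weight X w c t)%R, t; split; first lia.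
    by rewrite ltnW // subrK.
  by rewrite tr St mulrzDr addrA subrK.
exists (j - d *~ (walk_weight X w c t - walk_weight X w c N))%R, t.+1.
rewrite (leqNgt t.+2 r) (leqNgt t.+1 r) !ltnS rt (leqW rt) /= St; split=> //.
  by rewrite subrK.
rewrite [(walk_weight _ _ _ _ + _ - _)%R]addrAC.
by rewrite (mulrzDr _ (_ - _)%R) addrA subrK.
Qed.

Lemma lift_with_loop_loop k (X : finType) w (c : nat -> X) N r
    (d j : 'I_k.*2.+1) :
  exists i, lift_with_loop k X w c N r i d r.+1 = (j, c r) /\
    lift_with_loop k X w c N r i d r = (j + d *~ walk_weight X w c N, c r)%R.
Proof.
rewrite /lift_with_loop leqnn ltnn /=.
exists (j - d *~ (walk_weight X w c r - walk_weight X w c N))%R.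
by rewrite subrK mulrzBr opprB addrA subrK.
Qed.

Lemma perm_lift_with_loop k (X : finType) w (c : nat -> X) N r
    (i d : 'I_k.*2.+1) : r < N ->
  perm_eq (map snd (mkseq (lift_with_loop k X w c N r i d) N.+1))
          (c r :: mkseq c N).
Proof.
move=> rN; set L := lift_with_loop _ _ _ _ _ _ _ _.
have -> : map snd (mkseq L N.+1) =
    map c (iota 0 r) ++ c r :: map c (iota r (N - r)).
  rewrite /mkseq -map_comp (_ : N.+1 = r + (N - r).+1); last by lia.
  rewrite iotaD map_cat /= /L /lift_with_loop /= leqnn; congr (_ ++ _ :: _).
    by apply/eq_in_map => t; rewrite mem_iota /= => tr; rewrite ltnW.
  rewrite -(addn1 r) addnC iotaDl -map_comp; apply/eq_in_map => t.
  by rewrite mem_iota /= add1n => /andP[rt _]; rewrite (leqNgt t.+1) ltnS rt.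
by rewrite perm_catC /= perm_cons perm_catC -map_cat -iotaD subnKC // ltnW.
Qed.

(** * Assembling the lifts into a decomposition *)

Lemma lifted_decomposition n k (X : finType) (h : 'I_n -> nat -> X)
    (c : X -> nat -> X) (w : X -> X -> int) (p : X -> X) (col : X -> bool) :
  0 < n -> #|X| = n.*2.+1 ->
  (forall j, {in gtn n.*2.+1 &, injective (h j)}) ->
  (forall j, h j n.*2.+1 = h j 0) ->
  (forall x y, x != y -> exists j t,
     t < n.*2.+1 /\
     (h j t = x /\ h j t.+1 = y \/ h j t = y /\ h j t.+1 = x)) ->
  (forall a, {in gtn n.*2 &, injective (c a)}) ->
  (forall a, c a n.*2 = c a 0) ->
  (forall a t, t < n.*2 -> c a t != a) ->
  (forall x y, x != y -> exists a t, [/\ t < n.*2, c a t = x & c a t.+1 = y]) ->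
  (forall x y, w x y = w y x) ->
  (forall x y, signed_pow2 (w x y)) ->
  (forall a, signed_pow2 (walk_weight X w (c a) n.*2)) ->
  injective p -> (forall a, p a != a) -> (forall a, col (p a) = col a) ->
  (forall b, let q := #|[pred x | col x == b]| in (q == n) || (q == n.+1)) ->
  exists D, cycle_decomposition (V:='I_(n.*2.+1 * k.*2.+1)) n.*2.+1 D
    /\ equitably_2_colourable n.*2.+1 D.
Proof.
move=> n0 cardX h_inj hl h_cov c_inj cl ca c_cov w_sym w2 cw2 p_inj pa pcol Xcol.
(* By counting, the 2n distinct vertices of [c a] and the missed vertex [a] exhaust X. *)
have cperm a : perm_eq (a :: mkseq (c a) n.*2) (enum X).
  have u : uniq (a :: mkseq (c a) n.*2).
    rewrite /= (introT (mkseq_uniqP _ _) (c_inj a)) andbT.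
    apply/mapP=> -[t]; rewrite mem_iota /= => tn /esym/eqP.
    by rewrite (negPf (ca a t tn)).
  rewrite uniq_perm ?enum_uniq // => x; rewrite mem_enum; move: x.
  move/card_uniqP: u => /=; rewrite size_mkseq -cardX => u.
  have /subset_cardP e : #|a :: mkseq (c a) n.*2| = #|X| by [].
  by apply/e; apply: subset_predT.
have hperm j : perm_eq (mkseq (h j) n.*2.+1) (enum X).
  have u : uniq (mkseq (h j) n.*2.+1) by apply/mkseq_uniqP.
  rewrite uniq_perm ?enum_uniq // => x; rewrite mem_enum; move: x.
  move/card_uniqP: u; rewrite size_mkseq => u.
  have /subset_cardP e : #|mkseq (h j) n.*2.+1| = #|X| by rewrite u cardX.
  by apply/e; apply: subset_predT.
have countX b : let q := count (fun x => col x == b) (enum X) in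
    (q == n.*2.+1./2) || (q == uphalf n.*2.+1).
  have e : count (fun x => col x == b) (enum X) = #|[pred x | col x == b]|.
    by rewrite enumT cardE /enum_mem size_filter; apply: eq_count.
  by rewrite /= e; have /orP[/eqP->|/eqP->] := Xcol b; lia.
(* The loop goes where [c a] meets [p a]. *)
pose r a := index (p a) (mkseq (c a) n.*2).
have pc a : p a \in mkseq (c a) n.*2.
  have := perm_mem (cperm a) (p a).
  by rewrite mem_enum in_cons (negPf (pa a)) /= => ->.
have rN a : r a < n.*2 by rewrite -(size_mkseq (c a) n.*2) index_mem.
have cr a : c a (r a) = p a by rewrite -(nth_mkseq (p a) _ (rN a)) nth_index.
(* Left: Hamiltonian cycles in each fibre. Right: all translates [i] of the lift of [c a] with
   multiplier [d.+1]. *)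
pose A : finType := (('I_k.*2.+1 * 'I_n) + ('I_k.*2.+1 * ('I_k * X)))%type.
pose F (u : A) t : 'I_k.*2.+1 * X := match u with
  | inl (i, j) => (i, h j t)
  | inr (i, (d, a)) => lift_with_loop k X w (c a) n.*2 (r a) i (inord d.+1) t
  end.
have cardV : #|{: 'I_k.*2.+1 * X}| = n.*2.+1 * k.*2.+1.
  by rewrite card_prod card_ord cardX mulnC.
pose f x : 'I_(n.*2.+1 * k.*2.+1) := cast_ord cardV (enum_rank x).
pose g x : 'I_k.*2.+1 * X := enum_val (cast_ord (esym cardV) x).
have fK : cancel f g by move=> x; rewrite /f /g cast_ordK enum_rankK.
have gK : cancel g f by move=> x; rewrite /f /g enum_valK cast_ordKV.
apply: (decomposition_of_cover _ A n.*2.+1 (fun u t => f (F u t))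
          (fun x => col (g x).2))
  => [|[[i j]|[i [d a]]]|[[i j]|[i [d a]]]|x y xy||[[i j]|[i [d a]]] b].
- lia.
- by move=> s t sn tn /(can_inj fK) /(congr1 snd) /= /h_inj; apply.
- move=> s t sn tn /(can_inj fK) /lift_with_loop_inj; apply=> //.
  apply/eqP=> d0; have := signed_pow2_inj k _ (cw2 a) (inord d.+1) 0%R.
  rewrite d0 mul0rz => /(_ erefl) /(congr1 val) /=.
  by rewrite inordK //; have := ltn_ord d; lia.
- by rewrite /= hl.
- by rewrite /= lift_with_loop_closed.
- have gxy : g x != g y by rewrite (can_eq gK).
  rewrite -(gK x) -(gK y); case: (g x) (g y) gxy => i x' [j y'] {x y}xy.
  pose adj v1 v2 := exists u t, t < n.*2.+1 /\
     (F u t = v1 /\ F u t.+1 = v2 \/ F u t = v2 /\ F u t.+1 = v1).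
  suff [u [t [tn [[<- <-]|[<- <-]]]]] : adj (i, x') (j, y').
    - by exists u, t.
    - by exists u, t; split=> //; rewrite setUC.
  have [ij|ij] := eqVneq i j.
    have xy' : x' != y' by apply: contra_neq xy => ->; rewrite ij.
    have [v [t [tn e]]] := h_cov _ _ xy'.
    exists (inl (i, v)), t; split=> //=; rewrite -ij.
    by case: e => -[-> ->]; [left | right].
  (* One weight serves both orders of [x'] and [y'], so [half_system] may return either sign of the
     difference. *)
  have [wt [wt2 adjP]] : exists wt, signed_pow2 wt /\ forall (d : 'I_k) i1,
      let i2 := (i1 + inord d.+1 *~ wt)%R in
      adj (i1, x') (i2, y') /\ adj (i1, y') (i2, x').
    have [<-|xy'] := eqVneq x' y'.
      (* Equal X-coordinates need a loop at [x'], which is the loop of the [a] with [p a = x']. *)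
      have [q _ qK] := injF_bij p_inj; pose a := q x'.
      exists (walk_weight X w (c a) n.*2); split=> // d i1 /=.
      suff ad : adj (i1, x') (i1 + inord d.+1 *~ walk_weight X w (c a) n.*2, x')%R.
        by [].
      have [i2] := lift_with_loop_loop k X w (c a) n.*2 (r a) (inord d.+1) i1.
      rewrite cr qK => -[e1 e2]; exists (inr (i2, (d, a))), (r a).
      by split; [exact: leqW | right].
    have stepP x1 y1 (d : 'I_k) i1 : x1 != y1 ->
        adj (i1, x1) (i1 + inord d.+1 *~ w x1 y1, y1)%R.
      case/c_cov=> a [t [tn <- <-]].
      have [i2 [s [sn e1 e2]]] :=
        lift_with_loop_step k X w (c a) n.*2 (r a) (inord d.+1) i1 t tn.
      by exists (inr (i2, (d, a))), s; split=> //; left.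
    exists (w x' y'); split=> // d i1 /=; split; first exact: stepP.
    by rewrite w_sym; apply: stepP; rewrite eq_sym.
  have [|d [ed|ed]] := half_system k wt (j - i)%R wt2.
  - by rewrite subr_eq0 eq_sym.
  - by have [+ _] := adjP d i; rewrite -ed addrC subrK.
  have [_] := adjP d j; rewrite -ed opprB addrC subrK.
  by case=> u [t [tn e]]; exists u, t; split=> //; case: e; [right | left].
- have cI : #|A| = (k.*2.+1 * n + k.*2.+1 * (k * n.*2.+1))%N.
    by rewrite card_sum !card_prod !card_ord cardX.
  rewrite cI card_ord bin2.
  set N := (_ * k.*2.+1)%N; have -> : N.-1 = (n + k * n.*2.+1).*2 by lia.
  by rewrite -doubleMr doubleK /N; lia.
- have -> : count (fun x => col (g x).2 == b)
      (mkseq (fun t => f (F (inl (i, j)) t)) n.*2.+1) =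
      count (fun x => col x == b) (mkseq (h j) n.*2.+1).
    by rewrite !count_map; apply: eq_count => t /=; rewrite fK.
  by rewrite (permP (hperm j)); apply: countX.
- have -> : count (fun x => col (g x).2 == b)
      (mkseq (fun t => f (F (inr (i, (d, a))) t)) n.*2.+1) =
      count (fun x => col x == b) (map snd (mkseq
        (lift_with_loop k X w (c a) n.*2 (r a) i (inord d.+1)) n.*2.+1)).
    by rewrite !count_map; apply: eq_count => t /=; rewrite fK.
  (* The second visit to [p a] replaces the missed [a] of the same colour. *)
  rewrite (permP (perm_lift_with_loop _ _ _ _ _ _ _ _ (rN a))) /= cr pcol.
  have /= -> := permP (cperm a) (fun x => col x == b).
  exact: countX.
Qed.

(** * Walecki's cycles and their short-cuts *)

(* Walecki's zigzag j, j+1, j-1, j+2, j-2, ..., j+n modulo 2n. *)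
Definition zigzag n j t :=
  if odd t then (if j + uphalf t < n.*2 then j + uphalf t
                 else j + uphalf t - n.*2)
  else (if t./2 <= j then j - t./2 else j + n.*2 - t./2).

Lemma zigzag_even n j u :
  zigzag n j u.*2 = if u <= j then j - u else j + n.*2 - u.
Proof. by rewrite /zigzag odd_double doubleK. Qed.

Lemma zigzag_odd n j u :
  zigzag n j u.*2.+1 = if j + u.+1 < n.*2 then j + u.+1 else j + u.+1 - n.*2.
Proof. by rewrite /zigzag /= odd_double /= doubleK. Qed.

Lemma zigzag_lt n j t : j < n.*2 -> t < n.*2 -> zigzag n j t < n.*2.
Proof. by move=> jn tn; rewrite /zigzag; repeat case: ifP; lia. Qed.

Lemma zigzag_inj n j s t : j < n.*2 -> s < n.*2 -> t < n.*2 ->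
  zigzag n j s = zigzag n j t -> s = t.
Proof. by move=> jn sn tn; rewrite /zigzag; repeat case: ifP; lia. Qed.

(** Zigzags [j] and [j - n] are reversals of each other, so n of them suffice for unordered
    pairs. *)
Lemma zigzag_rev n j t : n <= j -> j < n.*2 -> t < n.*2 ->
  zigzag n (j - n) (n.*2 - t.+1) = zigzag n j t.
Proof. by move=> nj jn tn; rewrite /zigzag; repeat case: ifP; lia. Qed.

(** The steps have differences 1, -2, 3, -4, ... modulo 2n, so every nonzero residue occurs; the
    rotation [j] then adjusts the start. *)
Lemma zigzag_cover n x y : x < n.*2 -> y < n.*2 -> x != y ->
  exists j t, [/\ j < n.*2, t.+1 < n.*2, zigzag n j t = x & zigzag n j t.+1 = y].
Proof.
move=> xn yn xy.
pose d := if x <= y then y - x else y + n.*2 - x.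
have dE : (y = if x + d < n.*2 then x + d else x + d - n.*2) /\ 0 < d < n.*2.
  by rewrite /d; repeat case: ifP; lia.
move: d dE => d [dE dn].
have [od|ed] := boolP (odd d).
  have [t dt] : exists t, d = t.*2.+1 by exists d./2; lia.
  exists (if x + t < n.*2 then x + t else x + t - n.*2), t.*2.
  by rewrite zigzag_even zigzag_odd; split; move: dE; repeat case: ifP; lia.
have [t dt] : exists t, d = n.*2 - t.*2.+2 by exists (n.-1 - d./2); lia.
exists (if t.+1 <= x then x - t.+1 else x + n.*2 - t.+1), t.*2.+1.
by rewrite -doubleS zigzag_even zigzag_odd; split; move: dE; repeat case: ifP; lia.
Qed.

(** Only the first and last steps have difference 1 or -1; the bounds on [t] exclude them. Reduction
    modulo 2n keeps the parity of the difference. *)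
Lemma zigzag_step n j t : j < n.*2 -> 0 < t -> t.+2 < n.*2 ->
  let y := zigzag n j t in let z := zigzag n j t.+1 in
  [/\ y.+1 != z, z.+1 != y, (minn y z == 0) && ((maxn y z).+1 == n.*2) = false
    & odd (y + z) = ~~ odd t].
Proof.
move=> jn t0 tn.
have [u [ut|ut]] : exists u, t = u.*2.+1 \/ t = u.*2 by exists t./2; lia.
- rewrite ut -doubleS zigzag_even zigzag_odd.
  by repeat case: ifP; split; lia.
rewrite ut zigzag_even zigzag_odd.
by repeat case: ifP; split; lia.
Qed.

(* The point at infinity is coded by [n.*2]. *)
Definition walecki n j t :=
  if (t == 0) || (t == n.*2.+1) then n.*2 else zigzag n j t.-1.

(* For [a < 2n] the Hamiltonian cycle [walecki n a] with the vertex [a] short-cut;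
   the short-cuts leave exactly the cycle for [a = 2n]. *)
Definition near_walecki n a t :=
  if a == n.*2 then (if t < n.*2 then t else 0)
  else if (t == 0) || (t == n.*2) then n.*2 else zigzag n a t.

Lemma walecki_cover n x y : 1 < n -> x < n.*2.+1 -> y < n.*2.+1 -> x != y ->
  exists j t, [/\ j < n, t < n.*2.+1 &
    walecki n j t = x /\ walecki n j t.+1 = y \/
    walecki n j t = y /\ walecki n j t.+1 = x].
Proof.
move=> n1 xn yn xy.
have inf z : z < n.*2 -> exists j t, [/\ j < n, t < n.*2.+1 &
    walecki n j t = z /\ walecki n j t.+1 = n.*2 \/
    walecki n j t = n.*2 /\ walecki n j t.+1 = z].
  move=> zn; have [zl|zl] := ltnP z n.
    (* Cycle [j] leaves infinity towards [j] and returns to it from [j + n]. *)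
    exists z, 0; split=> //; right; rewrite /walecki /zigzag /=.
    by split=> //; repeat case: ifP; lia.
  exists (z - n), n.*2; split; try lia.
  left; rewrite /walecki eqxx orbT /zigzag; split=> //.
  by repeat case: ifP; lia.
have [xN|xN] := eqVneq x n.*2.
  have [|j [t [jn tn e]]] := inf y; first lia.
  by exists j, t; split; rewrite // xN; case: e; [right | left].
have [yN|yN] := eqVneq y n.*2.
  by rewrite yN; apply: inf; lia.
have [||j [t [jn tn zx zy]]] := zigzag_cover n x y _ _ xy; try lia.
have [jl|jl] := ltnP j n.
  exists j, t.+1; split; try lia.
  by left; rewrite /walecki !ifF /= ?zx ?zy //; lia.
exists (j - n), (n.*2 - t.+1); split; try lia.
right; rewrite /walecki !ifF; try lia; rewrite -zx -zy.
rewrite -!(zigzag_rev n j) ?(ltnW tn) //.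
by split; congr zigzag; lia.
Qed.

Lemma near_walecki_cover n x y :
  1 < n -> x < n.*2.+1 -> y < n.*2.+1 -> x != y ->
  exists a t, [/\ a < n.*2.+1, t < n.*2, near_walecki n a t = x &
    near_walecki n a t.+1 = y].
Proof.
move=> n1 xn yn xy.
have [xN|xN] := eqVneq x n.*2.
  (* After the short-cut, infinity is followed by [a + 1] modulo 2n. *)
  exists (if y == 0 then n.*2.-1 else y.-1), 0.
  by rewrite /near_walecki /zigzag; split; repeat case: ifP; lia.
have [yN|yN] := eqVneq y n.*2.
  exists (if n <= x then x - n else x + n), n.*2.-1.
  by rewrite /near_walecki /zigzag; split; repeat case: ifP; lia.
have [||j [t [jn tn zx zy]]] := zigzag_cover n x y _ _ xy; try lia.
(* Step 0, from [j] to [j + 1], is lost in the short-cut and is found on the cycle 0, 1, ...,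
   2n-1. *)
have [t0|t0] := posnP t.
  exists n.*2, x; move: zx zy; rewrite t0 /near_walecki /zigzag /= subn0.
  by repeat case: ifP; split; lia.
exists j, t; rewrite /near_walecki; split; try lia.
  by rewrite !ifF; lia.
by rewrite !ifF; lia.
Qed.

(** * Signs and total weights *)

(* The signs [odd (x + y)] alone would give the cycle 0, 1, ..., 2n-1 the weight
   -2n, which need not be a unit; hence the exceptions for cyclic neighbours. *)
Definition weight_sign n x y :=
  if (x == n.*2) || (y == n.*2) then false
  else if (x.+1 == y) || (y.+1 == x) then odd (minn x y)
  else if (minn x y == 0) && ((maxn x y).+1 == n.*2) then false
  else odd (x + y).

Lemma sum_signs m : (\sum_(0 <= s < m) (-1) ^+ s = (odd m)%:R :> int)%R.
Proof.
elim: m => [|m IH]; first by rewrite big_geq.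
by rewrite big_nat_recr // IH /= -signr_odd; case: (odd m).
Qed.

Lemma walk_weight_near n a : 1 < n -> a <= n.*2 ->
  exists e, (\sum_(0 <= s < n.*2)
     (-1) ^+ weight_sign n (near_walecki n a s) (near_walecki n a s.+1)
     = (2 ^ e)%:Z :> int)%R.
Proof.
move=> n1 an; have Nn : n.*2 = n.*2.-1.+1 by lia.
have [->|a2n] := eqVneq a n.*2.
  (* The 2n-1 edges from [s] to [s.+1] alternate in sign and sum to 1; the closing edge adds 1. *)
  exists 1; rewrite {1}Nn big_nat_recr //=.
  rewrite (eq_big_nat _ _ (F2 := fun s => ((-1) ^+ s)%R)) => [|s /= sn].
    rewrite sum_signs (_ : weight_sign _ _ _ = false); last first.
      by rewrite /weight_sign /near_walecki eqxx; repeat case: ifP; lia.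
    by rewrite (_ : odd _ = true) //; lia.
  rewrite -[in RHS]signr_odd; congr ((-1) ^+ _)%R; congr nat_of_bool.
  by rewrite /weight_sign /near_walecki eqxx; repeat case: ifP; lia.
have [m Nm] : exists m, n.*2 = m.+3 by exists (n.*2 - 3); lia.
have nz s : 0 < s < n.*2 -> near_walecki n a s = zigzag n a s.
  by rewrite /near_walecki (negPf a2n); case: ifP => //; lia.
have n0 : near_walecki n a 0 = n.*2 by rewrite /near_walecki (negPf a2n).
have nN : near_walecki n a m.+3 = n.*2.
  by rewrite /near_walecki (negPf a2n) -Nm eqxx orbT.
have wN z : weight_sign n n.*2 z = false by rewrite /weight_sign eqxx.
have wN' z : weight_sign n z n.*2 = false by rewrite /weight_sign eqxx orbT.
have om : odd m by lia.
(* The two edges at infinity weigh 1 each, the first [m] zigzag edges alternate and sum to 1, and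
   the last zigzag edge, between cyclic neighbours, adds 1 or -1: the total is 4 or 2. *)
rewrite {1}Nm big_nat_recl // !big_nat_recr //= n0 nN wN wN' expr0.
rewrite (eq_big_nat _ _ (F2 := fun s => ((-1) ^+ s)%R)) => [|s /= sm].
  rewrite sum_signs om.
  by case: weight_sign; [exists 1 | exists 2].
rewrite !nz; try lia.
rewrite -[in RHS]signr_odd; congr ((-1) ^+ _)%R; congr nat_of_bool.
have an' : a < n.*2 by lia.
have [|||y1 y2 y3 yz] := zigzag_step n a s.+1; try lia.
have yN : zigzag n a s.+1 < n.*2 by apply: zigzag_lt; lia.
have zN : zigzag n a s.+2 < n.*2 by apply: zigzag_lt; lia.
by rewrite /weight_sign (negPf y1) (negPf y2) y3 yz !ltn_eqF //= negbK.
Qed.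

(** * The colouring and the final construction *)

(** The derangement [p]: it rotates the even numbers up to 2n, infinity included, and the odd ones
    separately. For [1 < n] both classes have at least two elements. *)
Definition parity_shift n x := if x.+2 <= n.*2 then x.+2 else n.*2 - x.

Lemma card_parity n b :
  #|[pred x : 'I_n.*2.+1 | odd x == b]| = if b then n else n.+1.
Proof.
rewrite cardE /enum_mem size_filter -enumT.
have -> : count (mem [pred x : 'I_n.*2.+1 | odd x == b]) (enum 'I_n.*2.+1) =
    count (fun x => odd x == b) (iota 0 n.*2.+1).
  by rewrite -val_enum_ord count_map.
elim: n => [|n IH]; first by case: b.
rewrite doubleS -(addn2 n.*2.+1) iotaD count_cat IH /= odd_double.
by case: b {IH}; lia.
Qed.

Lemma odd_multiple_decomposition n k : 1 < n ->
  exists D, cycle_decomposition (V := 'I_(n.*2.+1 * k.*2.+1)) n.*2.+1 D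
    /\ equitably_2_colourable n.*2.+1 D.
Proof.
move=> n1.
have near_lt a t : a < n.*2.+1 -> t <= n.*2 -> near_walecki n a t < n.*2.+1.
  move=> an tn; rewrite /near_walecki; case: eqP => a2n; first by case: ifP; lia.
  case: ifP => // t0; have : zigzag n a t < n.*2 by apply: zigzag_lt; lia.
  by lia.
have wal_lt j t : j < n -> t <= n.*2.+1 -> walecki n j t < n.*2.+1.
  move=> jn tn; rewrite /walecki; case: ifP => // t0.
  have : zigzag n j t.-1 < n.*2 by apply: zigzag_lt; lia.
  by lia.
apply: (lifted_decomposition n k 'I_n.*2.+1
  (fun j t => inord (walecki n j t)) (fun a t => inord (near_walecki n a t))
  (fun x y => (-1) ^+ weight_sign n x y)%R
  (fun x => inord (parity_shift n x)) (fun x => odd x)).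
- lia.
- by rewrite card_ord.
- move=> j s t; rewrite !inE => sl tl /(congr1 val).
  rewrite /= !inordK ?wal_lt //; try exact: ltnW.
  have zl u : 0 < u < n.*2.+1 -> zigzag n j u.-1 < n.*2.
    by move=> ul; apply: zigzag_lt; have := ltn_ord j; lia.
  rewrite /walecki; case: ifP => s0; case: ifP => t0; try lia.
  - by have := zl t; lia.
  - by have := zl s; lia.
  by move/zigzag_inj; have := ltn_ord j; lia.
- by move=> j; rewrite /walecki eqxx orbT.
- move=> x y xy.
  have [j [t [jn tn e]]] := walecki_cover n x y n1 (ltn_ord x) (ltn_ord y) xy.
  exists (Ordinal jn), t; split=> //.
  by case: e => -[-> ->]; rewrite !inord_val; [left | right].
- move=> a s t; rewrite !inE => sl tl /(congr1 val).
  have al := ltn_ord a; rewrite /= !inordK ?near_lt //; try exact: ltnW.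
  rewrite /near_walecki; case: eqVneq => an; first by rewrite sl tl.
  have zl u : u < n.*2 -> zigzag n a u < n.*2.
    by move=> ul; apply: zigzag_lt; lia.
  case: ifP => s0; case: ifP => t0; try lia.
  - by have := zl t; lia.
  - by have := zl s; lia.
  by move/zigzag_inj; lia.
- by move=> a; rewrite /near_walecki ltnn eqxx orbT if_same.
- move=> a t tn; apply/eqP=> /(congr1 val).
  have al := ltn_ord a; rewrite /= inordK ?near_lt //; last exact: ltnW.
  rewrite /near_walecki /zigzag; case: eqVneq => an; first by rewrite tn an; lia.
  by repeat case: ifP; lia.
- move=> x y xy.
  have [a [t [an tn e1 e2]]] :=
    near_walecki_cover n x y n1 (ltn_ord x) (ltn_ord y) xy.
  by exists (Ordinal an), t; split; rewrite //= ?e1 ?e2 inord_val.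
- move=> x y; congr (_ ^+ nat_of_bool _)%R.
  by rewrite /weight_sign; repeat case: ifP; lia.
- by move=> x y; exists 0; case: weight_sign.
- move=> a; have [e ew] := walk_weight_near n a n1 (ltn_ord a); exists e.
  rewrite /walk_weight (eq_big_nat _ _ (F2 := fun s => ((-1) ^+
    weight_sign n (near_walecki n a s) (near_walecki n a s.+1))%R)) ?ew //.
  by move=> s /= sn; rewrite !inordK ?near_lt // ltnW.
- move=> x y /(congr1 val); have xl := ltn_ord x; have yl := ltn_ord y.
  rewrite /parity_shift /= !inordK; try by case: ifP; lia.
  by move=> e; apply: val_inj => /=; move: e; repeat case: ifP; lia.
- move=> a; apply/eqP=> /(congr1 val); have al := ltn_ord a.
  by rewrite /parity_shift /= inordK; case: ifP; lia.
- move=> a; have al := ltn_ord a.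
  by rewrite /parity_shift /= inordK; case: ifP; lia.
- by move=> b; rewrite /= card_parity; case: b; rewrite eqxx ?orbT.
Qed.

Theorem theorem7 (l v : nat) (hl : 7 <= l) (hodd : odd l) (hv0 : 0 < v)
    (hv : v = l %[mod 2 * l]) :
  exists D : {set {set {set 'I_v}}},
    cycle_decomposition l D /\ equitably_2_colourable l D.
Proof.
have ln : l = l./2.*2.+1 by lia.
(* The remainder of [v] modulo [2 * l] is [l], which makes the cofactor of [l] odd. *)
have vk : v = l * (v %/ (2 * l)).*2.+1.
  rewrite {1}(divn_eq v (2 * l)) hv modn_small; last by lia.
  by rewrite mulnS -mul2n; lia.
rewrite vk ln; apply: odd_multiple_decomposition; lia.
Qed.
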